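(* Let $A$ be a finitely generated free group and let $T$ be its Cayley graph with respect to a free basis. Let $B$ be a group, $\varphi:A\to\mathrm{Aut}(B)$ a homomorphism, and suppose $G=B\rtimes_\varphi A$ is finitely generated. Let $\rho$ be the action of $G$ on $T$ induced by the projection $G\twoheadrightarrow A$ and the natural action of $A$ on $T$. Let $e\in\partial T$ be represented by the geodesic ray $\tau$. If $\varphi(A_k(\tau))=\varphi(A)$ for each $k\in\mathbb{Z}_{\ge0}$, then $e\in\Sigma^1(\rho)$.
   Context: **Conventions.** Multiplication in $G=B\rtimes_\varphi A$ is $(b_1,a_1)(b_2,a_2)=(b_1\varphi_{a_1}(b_2),a_1a_2)$. $T$ is a simplicial tree with edges of length 1 and vertex set $A$, and $A$ acts on it by left multiplication. **Rays and horoballs.** Points of $\partial T$ are represented uniquely by geodesic rays $\tau:[0,\infty)\to T$ with $\tau(0)=1\in A$; $\tau(\infty)$ denotes the point represented by $\tau$. For real $t$, $HB_t(\tau)=\bigcup_{l\ge\max\{0,t\}}\overline{\mathrm{Ball}_{l-t}(T,\tau(l))}$ (nested union of closed metric balls of radius $l-t$ centred at $\tau(l)$). For $k\in\mathbb{Z}$, $A_k(\tau)\subseteq A$ is the vertex set of $HB_k(\tau)$; equivalently $A_k(\tau)=\bigcup_{l\ge\max\{0,k\},\,l\in\mathbb{Z}}\overline{\mathrm{Ball}_{l-k}(A,\tau(l))}$, with closed balls in the word metric of $A$. **$\Sigma^1(\rho)$.** For an isometric action $\rho$ of $G$ on a proper CAT(0) space $M$ (here $M=T$), choose a non-empty free contractible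 $G$-CW-complex $Y$ and a continuous $G$-map $h:Y\to M$. For a geodesic ray $\tau$ and $t\in\mathbb{R}$ let $Y_{(\tau,t)}$ be the largest subcomplex of $Y$ contained in $h^{-1}(HB_t(\tau))$. Then $h$ is controlled connected over $\tau(\infty)$ if for every cocompact $G$-subspace $L\subseteq Y$ there is a cocompact $G$-subspace $L'\supseteq L$ such that for all $t\in\mathbb{R}$ there exists $\lambda(t)\ge0$ with: $( * )$ any two points of $Y_{(\tau,t)}\cap L$ can be connected by a path in $Y_{(\tau,t-\lambda(t))}\cap L'$; and $( ** )$ any two points of $Y_{(\tau,t+\lambda(t))}\cap L$ can be connected by a path in $Y_{(\tau,t)}\cap L'$. By a theorem of Bieri and Geoghegan this does not depend on the choice of $Y$ and $h$, and $\Sigma^1(\rho)$ is the set of $e\in\partial M$ over which $\rho$ is controlled connected. *)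

(* Defs.v *)
From HB Require Import structures.
From mathcomp Require Import all_boot all_order all_algebra.
From mathcomp Require Import all_classical all_reals all_analysis.
From mathcomp Require Import generic_quotient lra.

Set Implicit Arguments.
Unset Strict Implicit.
Unset Printing Implicit Defensive.

Import Order.TTheory GRing.Theory Num.Theory.
Import numFieldNormedType.Exports.

Local Open Scope classical_set_scope.
Local Open Scope group_scope.
Local Open Scope ring_scope.

Definition finitely_generated (G : groupType) : Prop :=
  exists s : seq G, forall H : set G,
    H 1%g -> (forall a b, H a -> H b -> H (a / b)%g) ->
    (forall a, a \in s -> H a) -> forall g, H g.

Section Automorphisms.
Variable B : groupType.

Record aut := Aut {
  aut_fun :> B -> B;
  aut_morph : {morph aut_fun : x y / (x * y)%g};
  aut_bij : bijective aut_fun }.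

HB.instance Definition _ := gen_eqMixin aut.
HB.instance Definition _ := gen_choiceMixin aut.

Lemma aut_ext (f g : aut) : f =1 g -> f = g.
Proof.
case: f g => [f fM fB] [g gM gB] /= /funext fg; subst g.
by rewrite (Prop_irrelevance fM gM) (Prop_irrelevance fB gB).
Qed.

Definition aut_one : aut :=
  @Aut idfun (fun _ _ => erefl) (@Bijective _ _ idfun idfun (frefl _) (frefl _)).

Lemma aut_mul_morph (f g : aut) : {morph f \o g : x y / (x * y)%g}.
Proof. by move=> x y /=; rewrite !aut_morph. Qed.

Definition aut_mul (f g : aut) : aut :=
  Aut (@aut_mul_morph f g) (bij_comp (aut_bij f) (aut_bij g)).

Lemma aut_inv_subproof (f : aut) : exists g, cancel f g /\ cancel g f.
Proof. by case: (aut_bij f) => g fg gf; exists g. Qed.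

Definition aut_inv_fun (f : aut) : B -> B := sval (cid (aut_inv_subproof f)).

Lemma aut_funK (f : aut) : cancel f (aut_inv_fun f).
Proof. exact: (svalP (cid (aut_inv_subproof f))).1. Qed.

Lemma aut_inv_funK (f : aut) : cancel (aut_inv_fun f) f.
Proof. exact: (svalP (cid (aut_inv_subproof f))).2. Qed.

Lemma aut_inv_morph (f : aut) : {morph aut_inv_fun f : x y / (x * y)%g}.
Proof.
by move=> x y; apply: (bij_inj (aut_bij f)); rewrite aut_morph !aut_inv_funK.
Qed.

Definition aut_inv (f : aut) : aut :=
  Aut (@aut_inv_morph f) (Bijective (@aut_inv_funK f) (@aut_funK f)).

Lemma aut_mulA : associative aut_mul.
Proof. by move=> f g h; apply: aut_ext. Qed.
Lemma aut_mul1 : left_id aut_one aut_mul.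
Proof. by move=> f; apply: aut_ext. Qed.
Lemma aut_mulr1 : right_id aut_one aut_mul.
Proof. by move=> f; apply: aut_ext. Qed.
Lemma aut_mulV : left_inverse aut_one aut_inv aut_mul.
Proof. by move=> f; apply: aut_ext => b /=; rewrite aut_funK. Qed.
Lemma aut_mulrV : right_inverse aut_one aut_inv aut_mul.
Proof. by move=> f; apply: aut_ext => b /=; rewrite aut_inv_funK. Qed.

HB.instance Definition _ :=
  isGroup.Build aut aut_mulA aut_mul1 aut_mulr1 aut_mulV aut_mulrV.

End Automorphisms.

Definition sdprod (A B : groupType) (phi : {multiplicative A -> aut B}) : Type :=
  (B * A)%type.

Section SemidirectProduct.
Variables (A B : groupType) (phi : {multiplicative A -> aut B}).
Local Notation sdprod := (sdprod phi).

HB.instance Definition _ := Choice.copy sdprod (B * A)%type.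

Definition sdprod_one : sdprod := (1%g, 1%g).
Definition sdprod_mul (u v : sdprod) : sdprod :=
  ((u.1 * phi u.2 v.1)%g, (u.2 * v.2)%g).
Definition sdprod_inv (u : sdprod) : sdprod :=
  ((phi u.2^-1 u.1^-1)%g, (u.2^-1)%g).

Lemma sdprod_phi1 : phi 1%g = 1%g.
Proof. by apply: (mulgI (phi 1%g)); rewrite -gmulfM !mulg1. Qed.

Lemma aut_fun1 (f : aut B) : f 1%g = 1%g.
Proof. by apply: (mulgI (f 1%g)); rewrite -aut_morph !mulg1. Qed.

Lemma sdprod_phiM a a' b : phi (a * a')%g b = phi a (phi a' b).
Proof. by rewrite gmulfM. Qed.

Lemma sdprod_mulA : associative sdprod_mul.
Proof.
move=> [b1 a1] [b2 a2] [b3 a3]; rewrite /sdprod_mul /=.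
by rewrite aut_morph sdprod_phiM !mulgA.
Qed.
Lemma sdprod_mul1 : left_id sdprod_one sdprod_mul.
Proof. by case=> b a; rewrite /sdprod_mul /= sdprod_phi1 !mul1g. Qed.
Lemma sdprod_mulr1 : right_id sdprod_one sdprod_mul.
Proof. by case=> b a; rewrite /sdprod_mul /= aut_fun1 !mulg1. Qed.
Lemma sdprod_mulV : left_inverse sdprod_one sdprod_inv sdprod_mul.
Proof.
by case=> b a; rewrite /sdprod_mul /= -aut_morph !mulVg aut_fun1.
Qed.
Lemma sdprod_mulrV : right_inverse sdprod_one sdprod_inv sdprod_mul.
Proof.
by case=> b a; rewrite /sdprod_mul /= -sdprod_phiM !mulgV sdprod_phi1 mulgV.
Qed.

HB.instance Definition _ := isGroup.Build sdprod
  sdprod_mulA sdprod_mul1 sdprod_mulr1 sdprod_mulV sdprod_mulrV.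

Definition sdprod_proj (u : sdprod) : A := u.2.

Lemma sdprod_projM : {morph sdprod_proj : u v / (u * v)%g}.
Proof. by []. Qed.

HB.instance Definition _ :=
  isMultiplicative.Build sdprod A sdprod_proj sdprod_projM.

End SemidirectProduct.

Section Words.
Variables (A : groupType) (n : nat).

(* The letter (i, true) stands for the i-th generator, (i, false) for its
   inverse. *)
Definition letter_val (x : 'I_n -> A) (l : 'I_n * bool) : A :=
  if l.2 then x l.1 else (x l.1)^-1%g.

Definition word_val (x : 'I_n -> A) (w : seq ('I_n * bool)) : A :=
  (\prod_(l <- w) letter_val x l)%g.

Definition inv_letter (l : 'I_n * bool) : 'I_n * bool := (l.1, ~~ l.2).

Definition reduced (w : seq ('I_n * bool)) : bool :=
  sorted (fun l l' => l' != inv_letter l) w.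

Record free_basis := FreeBasis {
  fb_gen :> 'I_n -> A;
  fb_free : forall a, exists! w, reduced w /\ word_val fb_gen w = a }.

Variable x : free_basis.

Lemma word_len_subproof (a : A) :
  exists k, `[< exists w, size w = k /\ word_val x w = a >].
Proof.
by have [w [[_ wa] _]] := fb_free x a; exists (size w); apply/asboolP; exists w.
Qed.

Definition word_len (a : A) : nat := ex_minn (word_len_subproof a).

Definition word_dist (a b : A) : nat := word_len (a^-1 * b)%g.

Lemma word_lenP a : exists w, size w = word_len a /\ word_val x w = a.
Proof. by rewrite /word_len; case: ex_minnP => k /asboolP. Qed.

Lemma word_len_le w : (word_len (word_val x w) <= size w)%N.
Proof.
rewrite /word_len; case: ex_minnP => k _; apply; apply/asboolP; by exists w.
Qed.

Lemma word_val_cat w w' : word_val x (w ++ w') = (word_val x w * word_val x w')%g.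
Proof. by rewrite /word_val big_cat. Qed.

Lemma word_val_rev w :
  word_val x (rev (map inv_letter w)) = ((word_val x w)^-1)%g.
Proof.
elim: w => [|l w IH]; first by rewrite /word_val !big_nil invg1.
rewrite map_cons rev_cons -cats1 word_val_cat IH -[l :: w]cat1s word_val_cat.
rewrite invgM; congr (_ * _)%g; rewrite /word_val !big_seq1 /letter_val /=.
by case: l.2; rewrite ?invgK.
Qed.

Lemma word_lenM a b : (word_len (a * b)%g <= word_len a + word_len b)%N.
Proof.
have [w [<- wa]] := word_lenP a; have [w' [<- wb]] := word_lenP b.
by rewrite -wa -wb -word_val_cat -size_cat word_len_le.
Qed.

Lemma word_lenV a : word_len (a^-1)%g = word_len a.
Proof.
suff le b : (word_len (b^-1)%g <= word_len b)%N.
  by apply/eqP; rewrite eqn_leq le -{1}[a]invgK le.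
have [w [<- wb]] := word_lenP b.
by rewrite -{1}wb -word_val_rev (leq_trans (word_len_le _))// size_rev size_map.
Qed.

Lemma word_len_eq0 a : (word_len a == 0%N) = (a == 1%g).
Proof.
apply/eqP/eqP => [a0|->]; last first.
  by apply/eqP; rewrite -leqn0 -[1%g](_ : word_val x [::] = _) ?word_len_le //
    /word_val big_nil.
have [w []] := word_lenP a; rewrite a0 => /size0nil -> <-.
by rewrite /word_val big_nil.
Qed.

Lemma word_dist_sym a b : word_dist a b = word_dist b a.
Proof. by rewrite /word_dist -word_lenV invgM invgK. Qed.

Lemma word_dist_triangle b a c :
  (word_dist a c <= word_dist a b + word_dist b c)%N.
Proof.
rewrite /word_dist (_ : (a^-1 * c)%g = (a^-1 * b * (b^-1 * c))%g) ?word_lenM //.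
by rewrite mulgA -(mulgA a^-1%g) mulgV mulg1.
Qed.

Lemma word_distxx a : word_dist a a = 0%N.
Proof. by apply/eqP; rewrite /word_dist word_len_eq0 mulVg. Qed.

Lemma word_dist_eq0 a b : word_dist a b = 0%N -> a = b.
Proof.
move/eqP; rewrite /word_dist word_len_eq0 => /eqP ab.
by apply: (mulgI a^-1%g); rewrite ab mulVg.
Qed.

Lemma word_distMl c a b : word_dist (c * a)%g (c * b)%g = word_dist a b.
Proof. by rewrite /word_dist invgM -!mulgA (mulgA c^-1%g) mulVg mul1g. Qed.

Lemma word_dist_gen a i : word_dist a (a * x i)%g = 1%N.
Proof.
rewrite /word_dist mulgA mulVg mul1g; apply/eqP; rewrite eqn_leq; apply/andP.
split.
  rewrite (_ : fb_gen x i = word_val x [:: (i, true)]) ?word_len_le //.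
  by rewrite /word_val big_seq1.
rewrite lt0n word_len_eq0; apply/eqP => xi1.
have [w [_ wP]] := fb_free x 1%g.
have w0 : w = [::] by apply: wP; rewrite /word_val big_nil.
have : w = [:: (i, true)].
  by apply: wP; rewrite /word_val big_seq1 /letter_val.
by rewrite w0.
Qed.

End Words.

(* [Inner a i s] is the point at distance s from a in the interior of the edge
   from a to a * x i; every point of the tree has exactly one such form. *)
Inductive cayley_tree (R : realType) (A : groupType) (n : nat)
    (x : free_basis A n) :=
| Vertex of A
| Inner (a : A) (i : 'I_n) (s : R) of 0 < s < 1.

Arguments Vertex R {A n} x a.
Arguments Inner {R A n} x a i {s}.

Section CayleyTree.
Variables (R : realType) (A : groupType) (n : nat) (x : free_basis A n).
Local Notation cayley_tree := (cayley_tree R x).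

HB.instance Definition _ := gen_eqMixin cayley_tree.
HB.instance Definition _ := gen_choiceMixin cayley_tree.

(* [near_end p] and [far_end p] are the two ends of the edge carrying p, with the
   distances from p to them; for a vertex, both ends are the vertex itself. *)
Definition near_end (p : cayley_tree) : A :=
  match p with @Vertex _ _ _ _ a => a | @Inner _ _ _ _ a _ _ _ => a end.
Definition far_end (p : cayley_tree) : A :=
  match p with @Vertex _ _ _ _ a => a | @Inner _ _ _ _ a i _ _ => (a * x i)%g end.
Definition near_off (p : cayley_tree) : R :=
  match p with @Vertex _ _ _ _ _ => 0 | @Inner _ _ _ _ _ _ s _ => s end.
Definition far_off (p : cayley_tree) : R :=
  match p with @Vertex _ _ _ _ _ => 0 | @Inner _ _ _ _ _ _ s _ => 1 - s end.

Definition dist_vertex (p : cayley_tree) (c : A) : R :=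
  Num.min (near_off p + (word_dist x (near_end p) c)%:R)
          (far_off p + (word_dist x (far_end p) c)%:R).

(* Length of a shortest path from p to q through an end of each of their
   edges. *)
Definition dist_through (p q : cayley_tree) : R :=
  Num.min (dist_vertex p (near_end q) + near_off q)
          (dist_vertex p (far_end q) + far_off q).

Definition tree_dist (p q : cayley_tree) : R :=
  match p, q with
  | @Inner _ _ _ _ a i s _, @Inner _ _ _ _ b j t _ =>
      if (a == b) && (i == j) then `|s - t| else dist_through p q
  | _, _ => dist_through p q
  end.

Definition an_end (p : cayley_tree) (c : A) (e : R) : Prop :=
  (c = near_end p /\ e = near_off p) \/ (c = far_end p /\ e = far_off p).

Lemma an_end_ge0 p c e : an_end p c e -> 0 <= e.
Proof. by case: p => [a|a i s /= s01] [] [_ ->] //=; lra. Qed.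

Lemma dist_throughP p q : exists c e c' e', [/\ an_end p c e, an_end q c' e' &
  dist_through p q = e + (word_dist x c c')%:R + e'].
Proof.
rewrite /dist_through /dist_vertex; case: leP => _; case: leP => _.
- by exists (near_end p), (near_off p), (near_end q), (near_off q);
    split; rewrite // /an_end; auto.
- by exists (far_end p), (far_off p), (near_end q), (near_off q);
    split; rewrite // /an_end; auto.
- by exists (near_end p), (near_off p), (far_end q), (far_off q);
    split; rewrite // /an_end; auto.
- by exists (far_end p), (far_off p), (far_end q), (far_off q);
    split; rewrite // /an_end; auto.
Qed.

Lemma dist_through_le p q c e c' e' : an_end p c e -> an_end q c' e' ->
  dist_through p q <= e + (word_dist x c c')%:R + e'.
Proof.
by rewrite /dist_through /dist_vertex => -[] [-> ->] [] [-> ->];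
  rewrite !ge_min !lerD2r !ge_min !lexx ?orbT.
Qed.

Lemma an_end_dist p c1 e1 c2 e2 : an_end p c1 e1 -> an_end p c2 e2 ->
  (word_dist x c1 c2)%:R <= e1 + e2.
Proof.
case: p => [a|a i s /= s01] [] [-> ->] [] [-> ->] /=;
  rewrite ?word_distxx ?word_dist_gen ?addr0 //;
  rewrite ?(word_dist_sym _ (a * x i)%g) ?word_dist_gen; lra.
Qed.

Lemma natr_word_triangle b a c : (word_dist x a c)%:R <=
  (word_dist x a b)%:R + (word_dist x b c)%:R :> R.
Proof. by rewrite -natrD ler_nat word_dist_triangle. Qed.

Lemma dist_through_triangle q p r :
  dist_through p r <= dist_through p q + dist_through q r.
Proof.
have [c [e [c1 [e1 [pc qc1 ->]]]]] := dist_throughP p q.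
have [c2 [e2 [c' [e' [qc2 rc' ->]]]]] := dist_throughP q r.
have := dist_through_le pc rc'; have := an_end_dist qc1 qc2.
have := natr_word_triangle c2 c c'; have := natr_word_triangle c1 c c2; lra.
Qed.

Lemma dist_through_sym p q : dist_through p q = dist_through q p.
Proof.
suff le p' q' : dist_through p' q' <= dist_through q' p' by apply/le_anti/andP.
have [c [e [c' [e' [qc pc' ->]]]]] := dist_throughP q' p'.
by have := dist_through_le pc' qc; rewrite word_dist_sym; lra.
Qed.

Lemma dist_through_ge0 p q : 0 <= dist_through p q.
Proof.
have [c [e [c' [e' [/an_end_ge0 e0 /an_end_ge0 e'0 ->]]]]] := dist_throughP p q.
by rewrite !addr_ge0.
Qed.

Lemma an_end0 p c e : an_end p c e -> e = 0 -> p = Vertex R x c.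
Proof.
case: p => [a|a i s s01] [] [-> ->] //= s0; exfalso; lra.
Qed.

Lemma dist_through_eq0 p q : dist_through p q = 0 -> p = q.
Proof.
have [c [e [c' [e' [pc qc' ->]]]]] := dist_throughP p q => d0.
have := an_end_ge0 pc; have := an_end_ge0 qc'.
have w0 : 0 <= (word_dist x c c')%:R :> R by [].
move=> e'0 e0.
have eE : e = 0 by lra.
have e'E : e' = 0 by lra.
have /eqP : (word_dist x c c')%:R = 0 :> R by lra.
rewrite pnatr_eq0 => /eqP/word_dist_eq0 cc'.
by rewrite (an_end0 pc eE) (an_end0 qc' e'E) cc'.
Qed.

Lemma same_edge_through a i s s' t (s01 : 0 < s < 1) (s'01 : 0 < s' < 1) :
  dist_through (Inner x a i s01) t <=
  `|s - s'| + dist_through (Inner x a i s'01) t.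
Proof.
have [c [e [c' [e' [pc qc' ->]]]]] := dist_throughP (Inner x a i s'01) t.
have [d sd dO] : exists2 d, an_end (Inner x a i s01) c d & d <= `|s - s'| + e.
  case: pc => [] [/= -> ->]; [exists s|exists (1 - s)]; rewrite /an_end; auto;
    by case: (ler0P (s - s')) => ?; lra.
have := dist_through_le sd qc'; lra.
Qed.

Lemma same_edge_le a i s s' t (s01 : 0 < s < 1) (s'01 : 0 < s' < 1) :
  `|s - s'| <=
  dist_through (Inner x a i s01) t + dist_through t (Inner x a i s'01).
Proof.
have [c [e [c1 [e1 [pc tc1 ->]]]]] := dist_throughP (Inner x a i s01) t.
have [c2 [e2 [c' [e' [tc2 rc' ->]]]]] :=
  dist_throughP t (Inner x a i s'01).
have := an_end_dist tc1 tc2; have := natr_word_triangle c2 c c'.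
have := natr_word_triangle c1 c c2.
have : `|s - s'| <= e + (word_dist x c c')%:R + e'.
  case: pc rc' => [] [/= -> ->] [] [/= -> ->];
  rewrite ?word_distxx ?(word_dist_sym _ (a * x i)%g) ?word_dist_gen;
  by case: (ler0P (s - s')) => ?; lra.
lra.
Qed.

Lemma tree_distE p q :
  (exists a i s t (s01 : 0 < s < 1) (t01 : 0 < t < 1),
    [/\ p = Inner x a i s01, q = Inner x a i t01 & tree_dist p q = `|s - t|])
  \/ tree_dist p q = dist_through p q.
Proof.
case: p q => [a|a i s s01] [b|b j t t01] /=; try by right.
case: ifPn => [/andP[/eqP <- /eqP <-]|_]; last by right.
by left; exists a, i, s, t, s01, t01.
Qed.

Lemma tree_distxx p : tree_dist p p = 0.
Proof.
case: p => [a|a i s s01] /=; last by rewrite !eqxx subrr normr0.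
by rewrite /dist_through /dist_vertex /= !word_distxx !addr0 !minxx.
Qed.

Lemma tree_dist_eq0 p q : tree_dist p q = 0 -> p = q.
Proof.
have [[a [i [s [t [s01 [t01 [-> -> ->]]]]]]]|->] := tree_distE p q.
  move/eqP; rewrite normr_eq0 subr_eq0 => /eqP st; subst t.
  by rewrite (bool_irrelevance s01 t01).
exact: dist_through_eq0.
Qed.

Lemma tree_dist_sym p q : tree_dist p q = tree_dist q p.
Proof.
case: p q => [a|a i s s01] [b|b j t t01] /=; try exact: dist_through_sym.
by rewrite (eq_sym b) (eq_sym j) distrC dist_through_sym.
Qed.

Lemma tree_dist_through p q : tree_dist p q <= dist_through p q.
Proof.
have [[a [i [s [t [s01 [t01 [-> -> ->]]]]]]]|->] // := tree_distE p q.
have [c [e [c' [e' [pc rc' ->]]]]] :=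
  dist_throughP (Inner x a i s01) (Inner x a i t01).
case: pc rc' => [] [/= -> ->] [] [/= -> ->];
rewrite ?word_distxx ?(word_dist_sym _ (a * x i)%g) ?word_dist_gen;
by case: (ler0P (s - t)) => ?; lra.
Qed.

Lemma tree_dist_triangle q p r :
  tree_dist p r <= tree_dist p q + tree_dist q r.
Proof.
have [[a [i [s [t [s01 [t01 [-> -> ->]]]]]]]|->] := tree_distE p q.
- have [[b [j [u [v [u01 [v01 [[<- <- tu] -> ->]]]]]]]|->] :=
    tree_distE (Inner x a i t01) r.
    by rewrite /= !eqxx /= -tu ler_distD.
  apply: (le_trans (tree_dist_through _ _)); exact: same_edge_through.
- have [[a [i [s [t [s01 [t01 [-> -> ->]]]]]]]|->] := tree_distE q r.
    rewrite (le_trans (tree_dist_through _ _))// dist_through_sym.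
    rewrite (dist_through_sym p) addrC distrC.
    exact: same_edge_through.
  have [[a [i [s [t [s01 [t01 [-> -> ->]]]]]]]|->] := tree_distE p r.
    exact: same_edge_le.
  exact: dist_through_triangle.
Qed.

HB.instance Definition _ := isMetric.Build R cayley_tree
  tree_distxx tree_dist_eq0 tree_dist_sym tree_dist_triangle.

End CayleyTree.

Record group_action (G : groupType) (X : Type) := GroupAction {
  gact :> G -> X -> X;
  gact1 : forall p, gact 1%g p = p;
  gactM : forall g h p, gact (g * h)%g p = gact g (gact h p) }.

Record isometric_action (R : realType) (G : groupType) (M : metricType R) :=
  IsometricAction {
    iact :> group_action G M;
    iact_isom : forall g p q, mdist (iact g p) (iact g q) = mdist p q }.

Section TreeAction.
Variables (R : realType) (A B : groupType) (n : nat) (x : free_basis A n).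
Variable phi : {multiplicative A -> aut B}.
Local Notation T := (cayley_tree R x).

Definition translate (c : A) (p : T) : T :=
  match p with
  | @Vertex _ _ _ _ a => Vertex R x (c * a)%g
  | @Inner _ _ _ _ a i s s01 => Inner x (c * a)%g i s01
  end.

Lemma translate1 p : translate 1%g p = p.
Proof. by case: p => [a|a i s s01] /=; rewrite mul1g. Qed.

Lemma translateM c d p : translate (c * d)%g p = translate c (translate d p).
Proof. by case: p => [a|a i s s01] /=; rewrite mulgA. Qed.

Lemma translate_isom c p q :
  mdist (translate c p) (translate c q) = mdist p q.
Proof.
rewrite /mdist /=.
case: p q => [a|a i s s01] [b|b j t t01] /=; last first.
  rewrite (inj_eq (mulgI c)); case: ifP => // _.
all: by rewrite /dist_through /dist_vertex /= -?mulgA !word_distMl.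
Qed.

Definition tree_act (g : sdprod phi) (p : T) : T := translate (sdprod_proj g) p.

Lemma tree_act1 p : tree_act 1%g p = p.
Proof. exact: translate1. Qed.

Lemma tree_actM g h p : tree_act (g * h)%g p = tree_act g (tree_act h p).
Proof. by rewrite /tree_act gmulfM translateM. Qed.

Definition tree_action : isometric_action (sdprod phi) T :=
  @IsometricAction R _ T (GroupAction tree_act1 tree_actM)
    (fun g p q => translate_isom (sdprod_proj g) p q).

End TreeAction.

Section Rays.
Variables (R : realType) (M : metricType R).
Implicit Types tau : {nonneg R} -> M.

Definition geodesic_ray tau : Prop :=
  forall s t : {nonneg R}, mdist (tau s) (tau t) = `|s%:num - t%:num|.

Definition asymptotic tau tau' : Prop :=
  exists C : R, forall t, mdist (tau t) (tau' t) <= C.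

(* Boundary points are asymptoty classes of geodesic rays. *)
Definition ray_end tau : set ({nonneg R} -> M) :=
  [set tau' | geodesic_ray tau' /\ asymptotic tau tau'].

Definition boundary : set (set ({nonneg R} -> M)) :=
  [set ray_end tau | tau in [set tau | geodesic_ray tau]].

Definition horoball tau (t : R) : set M :=
  \bigcup_(l in [set l : {nonneg R} | t <= l%:num])
    [set p | mdist (tau l) p <= l%:num - t].

End Rays.

Definition horoball_vertices (R : realType) (A : groupType) (n : nat)
    (x : free_basis A n) (tau : {nonneg R} -> cayley_tree R x) (k : int) : set A :=
  [set a | horoball tau k%:~R (Vertex R x a)].

Section CW.
Variable R : realType.

Definition disk (m : nat) : set 'rV[R]_m :=
  [set v | \sum_(i < m) v ord0 i ^+ 2 <= 1].
Definition open_disk (m : nat) : set 'rV[R]_m :=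
  [set v | \sum_(i < m) v ord0 i ^+ 2 < 1].
Definition sphere (m : nat) : set 'rV[R]_m :=
  [set v | \sum_(i < m) v ord0 i ^+ 2 = 1].

(* Whitehead's definition: a Hausdorff space partitioned into open cells with
   characteristic maps, closure-finite and with the weak topology. *)
Record cw_structure (Y : topologicalType) := CWStructure {
  cell : Type;
  cell_dim : cell -> nat;
  char_map : forall c : cell, 'rV[R]_(cell_dim c) -> Y;
  open_cell := fun c : cell => @char_map c @` @open_disk (cell_dim c);
  closed_cell := fun c : cell => @char_map c @` @disk (cell_dim c);
  cw_hausdorff : hausdorff_space Y;
  char_map_continuous : forall c, {within @disk (cell_dim c), continuous (@char_map c)};
  char_map_inj : forall c u v, open_disk u -> open_disk v ->
    @char_map c u = @char_map c v -> u = v;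
  cell_partition : forall y, exists! c, open_cell c y;
  cell_boundary : forall c, exists E : set cell,
    [/\ finite_set E, (forall d, E d -> (cell_dim d < cell_dim c)%N) &
        @char_map c @` @sphere (cell_dim c) `<=` \bigcup_(d in E) open_cell d];
  (* The converse follows from the continuity of the characteristic maps. *)
  cw_weak : forall C : set Y,
    (forall c, closed (@disk (cell_dim c) `&` @char_map c @^-1` C)) -> closed C }.

(* As the open cells partition Y, such a Z is a union of open cells that contains
   the closure of each of them. *)
Definition subcomplex (Y : topologicalType) (K : cw_structure Y) (Z : set Y) :=
  forall c : cell K, open_cell c `&` Z !=set0 -> closed_cell c `<=` Z.

(* A union of subcomplexes is a subcomplex, so this is the largest one in W. *)
Definition largest_subcomplex (Y : topologicalType) (K : cw_structure Y)
    (W : set Y) : set Y :=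
  \bigcup_(Z in [set Z | subcomplex K Z /\ Z `<=` W]) Z.

(* The cellular actions of a discrete group G that make a CW complex a
   G-CW-complex. *)
Definition gcw_action (G : groupType) (Y : topologicalType)
    (K : cw_structure Y) (act : group_action G Y) : Prop :=
  [/\ forall g, continuous (act g),
      forall g (c : cell K), exists2 d : cell K,
        cell_dim d = cell_dim c & act g @` open_cell c = open_cell d &
      forall g (c : cell K), act g @` open_cell c = open_cell c ->
        forall y, open_cell c y -> act g y = y].

Definition free_action (G : groupType) (X : Type) (act : group_action G X) :=
  forall g y, act g y = y -> g = 1%g.

Definition contractible (Y : topologicalType) : Prop :=
  exists (y0 : Y) (H : R * Y -> Y),
    [/\ {within `[0, 1]%classic `*` [set: Y], continuous H},
        forall y, H (0, y) = y & forall y, H (1, y) = y0].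

Definition joined_in (Y : topologicalType) (Z : set Y) (y z : Y) : Prop :=
  exists f : R -> Y,
    [/\ {within `[0, 1]%classic, continuous f}, f 0 = y, f 1 = z &
        forall s, 0 <= s <= 1 -> Z (f s)].

End CW.

Section Cocompact.
Local Open Scope quotient_scope.
Variables (G : groupType) (Y : topologicalType) (act : group_action G Y).

Definition invariant (L : set Y) : Prop := forall g y, L y -> L (act g y).

Definition orbit_rel : rel Y := fun y z => `[< exists g, act g y = z >].

Lemma orbit_rel_refl : reflexive orbit_rel.
Proof. by move=> y; apply/asboolP; exists 1%g; rewrite gact1. Qed.

Lemma orbit_rel_sym : symmetric orbit_rel.
Proof.
suff imp y z : orbit_rel y z -> orbit_rel z y by move=> y z; apply/idP/idP => /imp.
move=> /asboolP[g <-]; apply/asboolP; exists g^-1%g.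
by rewrite -gactM mulVg gact1.
Qed.

Lemma orbit_rel_trans : transitive orbit_rel.
Proof.
move=> y x z /asboolP[g <-] /asboolP[h <-]; apply/asboolP.
by exists (h * g)%g; rewrite gactM.
Qed.

Canonical orbit_equiv := EquivRel orbit_rel
  orbit_rel_refl orbit_rel_sym orbit_rel_trans.

Definition orbit_space : topologicalType :=
  quotient_topology {eq_quot orbit_equiv}.

Definition orbit_proj : Y -> orbit_space := \pi_{eq_quot orbit_equiv}.

(* L is G-invariant with L / G compact. When G acts by homeomorphisms,
   [orbit_proj] is open, so the quotient topology on L / G is the subspace
   topology of Y / G. *)
Definition cocompact_subspace (L : set Y) : Prop :=
  invariant L /\ compact (orbit_proj @` L).

End Cocompact.

Section Sigma1.
Variables (R : realType) (G : groupType) (M : metricType R).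
Variable rho : isometric_action G M.

(* The auxiliary choice of a non-empty free contractible G-CW-complex with a
   continuous G-map to M. *)
Record control_map := ControlMap {
  cm_space :> topologicalType;
  cm_cw : cw_structure R cm_space;
  cm_act : group_action G cm_space;
  cm_gcw : gcw_action cm_cw cm_act;
  cm_free : free_action cm_act;
  cm_contractible : contractible R cm_space;
  cm_map : cm_space -> M;
  cm_continuous : continuous cm_map;
  cm_equivariant : forall g y, cm_map (cm_act g y) = rho g (cm_map y) }.

Variable h : control_map.

Definition over_horoball (tau : {nonneg R} -> M) (t : R) : set h :=
  largest_subcomplex (cm_cw h) (@cm_map h @^-1` horoball tau t).

Definition controlled_connected (tau : {nonneg R} -> M) : Prop :=
  forall L : set h, cocompact_subspace (cm_act h) L ->
  exists L' : set h,
    [/\ cocompact_subspace (cm_act h) L', L `<=` L' &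
    forall t : R, exists2 lambda : R, 0 <= lambda &
      (forall y z, (over_horoball tau t `&` L) y ->
         (over_horoball tau t `&` L) z ->
         joined_in R (over_horoball tau (t - lambda) `&` L') y z) /\
      (forall y z, (over_horoball tau (t + lambda) `&` L) y ->
         (over_horoball tau (t + lambda) `&` L) z ->
         joined_in R (over_horoball tau t `&` L') y z)].

(* Boundary points are represented by the rays starting at the point o. The set
   does not depend on the choice of h (Bieri and Geoghegan). *)
Definition Sigma1 (o : M) : set (set ({nonneg R} -> M)) :=
  [set ray_end tau | tau in [set tau | [/\ geodesic_ray tau, tau 0%:nng = o &
                                           controlled_connected tau]]].

End Sigma1.

(* Main.v *)
Require Import Defs.
From mathcomp Require Import all_boot all_order all_algebra.
From mathcomp Require Import all_classical all_reals all_analysis.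
From mathcomp Require Import lra.

Set Implicit Arguments.
Unset Strict Implicit.
Unset Printing Implicit Defensive.

Import Order.TTheory GRing.Theory Num.Theory.
Import numFieldNormedType.Exports.

Local Open Scope classical_set_scope.
Local Open Scope ring_scope.

(** Write o for the vertex 1 of the tree T and H_t for the horoball of level t
centred at the end of tau.

The group-theoretic heart is [sdprod_connected]. Elements of G = B ><| A are
pairs (b, a), lying over the vertex a of T, and there are two kinds of moves:
(b, a) to (b, a x_i), along an edge of T, and (b, a) to (b phi_a(b_s), a), which
stays over the vertex a; here b_s is the B-component of a generator s of G. As
these s generate G, the elements phi_a(b_s) with a in A generate B. The
hypothesis on phi says that each phi_a equals phi_a' for some vertex a' as deep
in the horoball as desired. So b can be changed into any b': walk horizontally
to such an a', multiply by phi_a'(b_s), walk back. Horizontal walks stay near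
the horoball, because two vertices of H_t lie in one ball centred on tau and are
both joined to its centre inside that ball; since the centre need not be a
vertex, [horoball_vertex_chain] only keeps the walk inside H_(t-2).

This is carried over to an arbitrary free contractible G-CW-complex Y with a
G-map h to T as follows. Given a cocompact L, [cocompact_sub_translates] gives a
compact subcomplex Z of Y which contains paths joining a base point y0 to its
images under the moves above, and to a translate of each point of L. By
compactness h(Z) has bounded distance D from o, so a translate gZ is mapped
within D of the vertex g.o, and a walk, however long, loses at most D in horoball
level when it is carried to Y. With L' the union of L and all translates of Z, one constant
lambda = 2D + 2 works for every t: one D is lost in passing from a point of L to
the vertex of the translate of Z next to it, the 2 in the horizontal walks, and
the second D in passing back from vertices to translates of Z.

The compact subcomplex exists because a compact set meets finitely many open
cells, and a cocompact one finitely many orbits of open cells. Both are cases of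
[compact_finite_classes]: points chosen in pairwise inequivalent cells form a
closed discrete set for the weak topology, and a compact space has no infinite
closed discrete subset. *)

(** * Compactness in topological and metric spaces *)

(** If D were infinite, the sets containing all but finitely many points of D
would form a proper filter without cluster point in K: the closed set D minus p
separates that filter from p. *)
Lemma compact_discrete_finite (X : topologicalType) (K D : set X) :
  compact K -> D `<=` K -> (forall S, S `<=` D -> closed S) -> finite_set D.
Proof.
move=> cK DK clD; apply: contrapT => infD.
pose F : set_system X := [set Z | finite_set (D `\` Z)].
have FF : ProperFilter F.
  split; first by rewrite /F /= setD0.
  split=> [|P Q FP FQ|P Q PQ FP]; rewrite /F /=.
  - by rewrite setDT; exact: finite_set0.
  - by rewrite setDIr finite_setU.
  - by apply: sub_finite_set FP => z [Dz nQ]; split=> // /PQ.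
have FK : F K by rewrite /F /=; move: DK; rewrite -setD_eq0 => ->.
have [p [_ clp]] := cK F FF FK.
have FDp : F (D `\ p).
  by apply: sub_finite_set (finite_set1 p) => z [Dz /not_andP[]// /contrapT].
have oU : nbhs p (~` (D `\ p)).
  apply: open_nbhs_nbhs; split; last by move=> [_ /(_ erefl)].
  by apply: closed_openC; apply: clD; exact: subDsetl.
by have [z [Dpz /(_ Dpz)]] := clp _ _ FDp oU.
Qed.

Lemma mdist_continuous (R : realType) (M : metricType R) (o : M) :
  continuous (mdist o : M -> R).
Proof.
move=> p; apply/cvgrPdist_lt => e e0; near=> q.
have pq : mdist p q < e.
  by have : ball p e q; [near: q; exact: nbhsx_ballx|rewrite ballEmdist].
rewrite (le_lt_trans _ pq)// ler_distl.
have := metric_triangle o p q; have := metric_triangle o q p.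
by rewrite (metric_sym q p); lra.
Unshelve. all: by end_near. Qed.

(** * Paths *)

Section Paths.
Variables (R : realType) (Y : topologicalType).
Implicit Types (Z : set Y) (y z w : Y).

Lemma within_comp_affine (f : R -> Y) (a b c d : R) :
  (forall s, c <= s <= d -> 0 <= a * s + b <= 1) ->
  {within `[0, 1]%classic, continuous f} ->
  {within `[c, d]%classic, continuous (fun s => f (a * s + b))}.
Proof.
move=> ab /subspace_continuousP cf; apply/subspace_continuousP => s cds.
have cds' : `[0, 1]%classic (a * s + b).
  by rewrite /= in_itv /=; apply: ab; move: cds; rewrite /= in_itv.
apply: cvg_trans (cf _ cds') => U.
rewrite !nbhs_simpl /= => fU.
have ca : (fun s => a * s + b) @ s --> a * s + b.
  by apply: cvgD; [apply: cvgM; [exact: cvg_cst|exact: cvg_id]|exact: cvg_cst].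
have /= := ca _ fU; rewrite /within /= => fU'.
near=> r => cdr.
have : `[c, d]%classic r -> 0 <= a * r + b <= 1 by rewrite /= in_itv /=; exact: ab.
move=> /(_ cdr) abr; have : `[0, 1]%classic (a * r + b) by rewrite /= in_itv.
by near: r.
Unshelve. all: by end_near. Qed.

Lemma joined_in_sym Z y z : joined_in R Z y z -> joined_in R Z z y.
Proof.
move=> [f [cf f0 f1 Zf]]; exists (fun s => f (-1 * s + 1)); split.
- by apply: within_comp_affine cf => s; lra.
- by rewrite mulr0 add0r.
- by rewrite mulr1 addNr.
- by move=> s s01; apply: Zf; lra.
Qed.

Lemma joined_in_trans Z y z w :
  joined_in R Z y z -> joined_in R Z z w -> joined_in R Z y w.
Proof.
move=> [f [cf f0 f1 Zf]] [g [cg g0 g1 Zg]].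
pose k s := if s <= 2^-1 then f (2 * s + 0) else g (2 * s + -1).
have half2 : 2 * 2^-1 = 1 :> R by rewrite mulfV.
exists k; split.
- have -> : `[0, 1]%classic = `[0, 2^-1] `|` `[2^-1, 1] :> set R.
    apply/seteqP; split=> s /=; rewrite !in_itv /=; last by case; lra.
    by case: (leP s 2^-1) => ?; [left|right]; lra.
  apply: withinU_continuous; [exact: itv_closed|exact: itv_closed| |].
  + have ck : {within `[0, 2^-1]%classic, continuous (fun s => f (2 * s + 0))}.
      by apply: within_comp_affine cf => s; lra.
    refine (subspace_eq_continuous _ ck) => s.
    by rewrite inE /= in_itv /= => /andP[_ s1]; rewrite /from_subspace /k s1.
  + have ck : {within `[2^-1, 1]%classic, continuous (fun s => g (2 * s + -1))}.
      by apply: within_comp_affine cg => s; lra.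
    refine (subspace_eq_continuous _ ck) => s.
    rewrite inE /= in_itv /= => /andP[s1 _]; rewrite /from_subspace /k.
    case: leP => // s2; have -> : s = 2^-1 by lra.
    by rewrite half2 subrr addr0 g0 f1.
- by rewrite /k ifT ?mulr0 ?addr0//; lra.
- by rewrite /k ifF; [rewrite mulr1 -[2]/(1 + 1) addrK|apply/negbTE; lra].
- by move=> s s01; rewrite /k; case: leP => sh; [apply: Zf|apply: Zg]; lra.
Qed.

Lemma joined_in_sub Z Z' y z : Z `<=` Z' -> joined_in R Z y z -> joined_in R Z' y z.
Proof. by move=> ZZ' [f [cf f0 f1 Zf]]; exists f; split=> // s /Zf/ZZ'. Qed.

End Paths.

Lemma joined_in_image (R : realType) (X Y : topologicalType) (f : X -> Y)
    (Z : set X) y z :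
  continuous f -> joined_in R Z y z -> joined_in R (f @` Z) (f y) (f z).
Proof.
move=> cf [p [cp p0 p1 Zp]]; exists (f \o p); split=> /=; rewrite ?p0 ?p1//.
  by apply: within_continuous_comp => // ? _; exact: cf.
by move=> s /Zp Zps; exists (p s).
Qed.

Lemma joined_in_compact (R : realType) (Y : topologicalType) (Z : set Y) y z :
  joined_in R Z y z -> exists P, [/\ compact P, P `<=` Z & joined_in R P y z].
Proof.
move=> [f [cf f0 f1 Zf]]; exists (f @` `[0, 1]%classic); split.
- by apply: continuous_compact cf _; exact: segment_compact.
- by move=> _ [s /= s01 <-]; apply: Zf; rewrite in_itv in s01.
- by exists f; split=> // s s01; exists s; rewrite //= in_itv.
Qed.

Lemma contractible_joined (R : realType) (Y : topologicalType) :
  contractible R Y -> exists y0 : Y, forall y, joined_in R [set: Y] y y0.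
Proof.
move=> [y0 [H [cH H0 H1]]]; exists y0 => y; exists (fun s => H (s, y)); split=> //.
apply/subspace_continuousP => s s01; move/subspace_continuousP: cH => /(_ (s, y)).
move=> /(_ (conj s01 I)); apply: cvg_trans => U /= HU.
have cs : continuous (fun r : R => (r, y)).
  by move=> r; exact: (cvg_pair cvg_id (cvg_cst y)).
have HU' := cs s _ HU.
rewrite !nbhs_simpl /= /within /=; near=> r => r01.
have : (r \in `[0, 1]) /\ True -> U (H (r, y)) by near: r; exact: HU'.
by apply.
Unshelve. all: by end_near. Qed.

(** * CW complexes *)

Section Disk.
Variables (R : realType) (m : nat).

Lemma sqnorm_continuous : continuous (fun v : 'rV[R]_m => \sum_(i < m) v ord0 i ^+ 2).
Proof.
apply: continuous_big => [|i _ v]; first exact: add_continuous.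
apply: (@continuous_comp _ _ _ (fun v : 'rV[R]_m => v ord0 i) (fun r : R => r ^+ 2)).
  exact: coord_continuous.
exact: exprn_continuous.
Qed.

Lemma disk_compact : compact (@disk R m).
Proof.
apply: bounded_closed_compact.
  exists 1; split=> // M M1 v /= dv; rewrite [leLHS]/Num.norm /= mx_normrE.
  apply/bigmax_leP; split=> [|[i j] _ /=]; first by rewrite ltW// (lt_trans ltr01).
  apply: ltW; apply: le_lt_trans M1; rewrite ord1.
  rewrite -(@expr_le1 _ 2)// -normrX ger0_norm ?sqr_ge0//.
  apply: le_trans dv; rewrite (bigD1 j)//= lerDl sumr_ge0// => k _; exact: sqr_ge0.
rewrite (_ : @disk R m = (fun v : 'rV[R]_m => \sum_(i < m) v ord0 i ^+ 2)
  @^-1` [set r | r <= 1]) //.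
by apply: preimage_closed; [move=> ? _; exact: sqnorm_continuous|exact: closed_le].
Qed.

Lemma sqnorm_scale (r : R) (v : 'rV[R]_m) :
  \sum_(i < m) (r *: v) ord0 i ^+ 2 = r ^+ 2 * \sum_(i < m) v ord0 i ^+ 2.
Proof. by rewrite mulr_sumr; apply: eq_bigr => i _; rewrite mxE exprMn. Qed.

Lemma scale_disk (r : R) (v : 'rV[R]_m) : 0 <= r <= 1 -> disk v -> disk (r *: v).
Proof.
rewrite /disk /= sqnorm_scale => /andP[r0 r1] dv.
have : 0 <= \sum_(i < m) v ord0 i ^+ 2 by apply: sumr_ge0 => ? _; exact: sqr_ge0.
by move: dv; have : r ^+ 2 <= 1 by [rewrite expr_le1]; nra.
Qed.

Lemma scale_open_disk (r : R) (v : 'rV[R]_m) : 0 <= r < 1 -> disk v -> open_disk (r *: v).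
Proof.
rewrite /disk /open_disk /= sqnorm_scale => /andP[r0 r1] dv.
have : 0 <= \sum_(i < m) v ord0 i ^+ 2 by apply: sumr_ge0 => ? _; exact: sqr_ge0.
by move: dv; have : r ^+ 2 < 1 by [rewrite expr_lt1]; nra.
Qed.

Lemma open_disk_sub : @open_disk R m `<=` @disk R m.
Proof. by move=> v /ltW. Qed.

End Disk.

Lemma finite_bigcup_compact (X : topologicalType) (I : choiceType) (E : set I)
    (F : I -> set X) :
  finite_set E -> (forall i, E i -> compact (F i)) -> compact (\bigcup_(i in E) F i).
Proof.
move=> /finite_seqP[s ->] cF; rewrite bigcup_seq.
rewrite big_seq; apply: bigsetU_compact => i; exact: cF.
Qed.

Section CWComplexes.
Variables (R : realType) (Y : topologicalType) (K : cw_structure R Y).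
Implicit Types (c d : cell K) (Z P : set Y) (y z : Y).

Lemma open_cell_sub c : open_cell c `<=` closed_cell c.
Proof. exact/image_subset/open_disk_sub. Qed.

Lemma open_cell_inj c d y : open_cell c y -> open_cell d y -> c = d.
Proof.
by move=> cy dy; have [e [_ eU]] := cell_partition K y; rewrite -(eU c) ?(eU d).
Qed.

Lemma closed_cell_compact c : compact (closed_cell c).
Proof. apply: continuous_compact; [exact: char_map_continuous|exact: disk_compact]. Qed.

Lemma closed_cell_closed c : closed (closed_cell c).
Proof. exact: compact_closed (cw_hausdorff K) (@closed_cell_compact c). Qed.

Lemma char_map_ray_continuous c (v : 'rV[R]_(cell_dim c)) : disk v ->
  {within `[0, 1]%classic, continuous (fun r : R => char_map (r *: v))}.
Proof.
move=> dv; have cc := @char_map_continuous _ _ K c.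
apply/subspace_continuousP => s s01; move/subspace_continuousP: cc => cc.
have s01' : 0 <= s <= 1 by move: s01; rewrite /= in_itv.
apply: cvg_trans (cc _ (scale_disk s01' dv)) => U /= HU.
have HU' := @scalel_continuous R 'rV[R]_(cell_dim c) v s _ HU.
rewrite !nbhs_simpl /= /within /=; near=> r => r01.
have : disk (r *: v) -> U (char_map (r *: v)) by near: r; exact: HU'.
by apply; apply: scale_disk dv; move: r01; rewrite in_itv.
Unshelve. all: by end_near. Qed.

(** The radial segment towards a point of the boundary sphere stays in the open
disk until its end. *)
Lemma closed_cell_sub_closure c : closed_cell c `<=` closure (open_cell c).
Proof.
move=> _ [v dv <-] B Bv.
have nB : \forall r \near (1 : R), 0 <= r <= 1 -> B (char_map (r *: v)).
  have /subspace_continuousP/(_ 1) := char_map_ray_continuous dv.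
  rewrite /from_subspace /= scale1r in_itv /= lexx ler01 => /(_ isT B Bv).
  by rewrite !nbhs_simpl /= /within /=; apply: filterS => r /=; rewrite in_itv.
have {}nB : \forall r \near 1^'-, 0 <= r <= 1 -> B (char_map (r *: v)).
  exact: cvg_within nB.
near (1 : R)^'- => r.
have r0 : 0 <= r by near: r; exact: nbhs_left_ge.
have r1 : r < 1 by near: r; exact: nbhs_left_lt.
exists (char_map (r *: v)); split.
  by exists (r *: v) => //; apply: scale_open_disk dv; rewrite r0 r1.
have : 0 <= r <= 1 by rewrite r0 ltW.
by near: r.
Unshelve. all: by end_near. Qed.

Lemma closed_cell_joined c y :
  closed_cell c y -> joined_in R (closed_cell c) (char_map (0 : 'rV_(cell_dim c))) y.
Proof.
move=> [v dv <-]; exists (fun r : R => char_map (r *: v)); split.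
- exact: char_map_ray_continuous.
- by rewrite scale0r.
- by rewrite scale1r.
- by move=> s s01; exists (s *: v) => //; exact: scale_disk.
Qed.

Lemma closed_cell_boundary c : exists E : set (cell K),
  [/\ finite_set E, (forall d, E d -> (cell_dim d < cell_dim c)%N) &
      closed_cell c `<=` open_cell c `|` \bigcup_(d in E) open_cell d].
Proof.
have [E [fE dE bE]] := cell_boundary c; exists E; split=> // _ [v dv <-].
have [ov|nov] := pselect (open_disk v); first by left; exists v.
right; apply: bE; exists v => //; apply/le_anti; rewrite dv /= leNgt.
exact/negP.
Qed.

(** Closure-finiteness makes the trace of Z on each closed cell finite. *)
Lemma closed_of_cells Z :
  (forall c y z, open_cell c y -> open_cell c z -> Z y -> Z z -> y = z) -> closed Z.
Proof.
move=> Zc; apply: cw_weak => c.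
have fin d : finite_set (Z `&` open_cell d).
  have [[z [Zz dz]]|Z0] := pselect (exists z, Z z /\ open_cell d z).
    by apply: sub_finite_set (finite_set1 z) => y [Zy dy] /=; exact: Zc dy dz Zy Zz.
  by apply: sub_finite_set (finite_set0 Y) => y [Zy dy]; apply: Z0; exists y.
have [E [fE _ cE]] := closed_cell_boundary c.
have fS : finite_set (Z `&` closed_cell c).
  apply: (@sub_finite_set _ _ ((Z `&` open_cell c) `|`
    \bigcup_(d in E) (Z `&` open_cell d))).
    move=> y [Zy /cE[cy|[d Ed dy]]]; first by left.
    by right; exists d.
  by rewrite finite_setU; split=> //; apply: (@bigcup_finite {classic (cell K)}).
have cS : closed (Z `&` closed_cell c).
  apply: accessible_finite_set_closed.1 fS; apply: hausdorff_accessible.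
  exact: (cw_hausdorff K).
have dcl : closed (@disk R (cell_dim c)).
  by apply: compact_closed (@disk_compact _ _); exact: norm_hausdorff.
rewrite (_ : _ `&` _ = disk (m:=cell_dim c) `&`
  @char_map _ _ _ c @^-1` (Z `&` closed_cell c)); last first.
  by apply/seteqP; split=> v [dv Zv]; split=> //; [split=> //; exists v|case: Zv].
rewrite closed_setSI//.
by move/continuous_closedP : (@char_map_continuous _ _ K c); apply.
Qed.

(** Two uses: q the identity of Y, with points equivalent when they lie in the
same open cell; and q the projection to the orbit space, with points equivalent
when their cells are translates of one another. Choosing one point of P in each
class gives a set whose image by q is closed and discrete, since its preimage
has at most one point in each open cell. *)
Lemma compact_finite_classes (X : topologicalType) (q : Y -> X) (sim : Y -> Y -> Prop) P :
  (forall C, closed (q @^-1` C) -> closed C) ->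
  (forall y z, sim y z -> sim z y) ->
  (forall y z w, sim y z -> sim z w -> sim y w) ->
  (forall c y z, open_cell c y -> open_cell c z -> sim y z) ->
  (forall y z, q y = q z -> sim y z) ->
  (forall c y z, open_cell c y -> open_cell c z -> q y = q z -> y = z) ->
  compact (q @` P) ->
  exists D, [/\ finite_set D, D `<=` P & forall y, P y -> exists2 p, D p & sim y p].
Proof.
move=> qcl simC simT simc simq qc cP.
have [[y0 Py0]|P0] := pselect (P !=set0); last first.
  by exists set0; split=> // y Py; case: P0; exists y.
pose rep y := xget y0 (P `&` sim y).
have simR y : sim y y by exact: simq.
have repP y : P y -> P (rep y) /\ sim y (rep y).
  by move=> Py; apply: (xgetPex y0 (P := P `&` sim y)); exists y.
have repE y z : sim y z -> rep y = rep z.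
  move=> yz; congr xget; apply/seteqP; split=> w [Pw yw]; split=> //.
    exact: simT (simC _ _ yz) yw.
  exact: simT yz yw.
exists (rep @` P); split; last 2 first.
- by move=> _ [y Py <-]; have [] := repP _ Py.
- by move=> y Py; exists (rep y); [exists y|have [] := repP _ Py].
have Dinj p p' : (rep @` P) p -> (rep @` P) p' -> sim p p' -> p = p'.
  move=> [y Py <-] [z Pz <-] s; apply: repE.
  have [_ s1] := repP _ Py; have [_ s2] := repP _ Pz.
  by apply: simT s1 (simT _ _ _ s (simC _ _ s2)).
have fq : finite_set (q @` (rep @` P)).
  apply: (compact_discrete_finite cP).
    by move=> _ [_ [y Py <-] <-]; exists (rep y) => //; have [] := repP _ Py.
  move=> S SD; apply: qcl; apply: closed_of_cells => c y z cy cz /= Sy Sz.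
  have [p Dp py] := SD _ Sy; have [p' Dp' pz] := SD _ Sz.
  apply: (qc _ _ _ cy cz); rewrite -py -pz; congr q; apply: Dinj => //.
  by apply: simT (simq _ _ py) (simT _ _ _ (simc _ _ _ cy cz) (simq _ _ (esym pz))).
have q_inj : {in rep @` P &, injective q}.
  by move=> p p' /set_mem Dp /set_mem Dp' /simq; exact: Dinj.
by rewrite (eq_finite_set (inj_card_eq q_inj)) in fq.
Qed.

(** By induction on the dimension: the boundary of a cell meets finitely many
open cells, all of smaller dimension. *)
Lemma cell_finite_subcomplex c : exists E : set (cell K),
  [/\ finite_set E, E c & subcomplex K (\bigcup_(d in E) open_cell d)].
Proof.
have [m] := ubnP (cell_dim c); elim: m c => // m IH c; rewrite ltnS => cm.
have [E0 [fE0 dE0 cE0]] := closed_cell_boundary c.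
have /choice[F FP] : forall d, exists E : set (cell K), E0 d ->
    [/\ finite_set E, E d & subcomplex K (\bigcup_(d in E) open_cell d)].
  move=> d; have [Ed|nEd] := pselect (E0 d); last by exists set0.
  by have [E EP] := IH d (leq_trans (dE0 d Ed) cm); exists E.
exists ([set c] `|` \bigcup_(d in E0) F d); split; last 2 first.
- by left.
- move=> c' [y [c'y [d Ed dy]]].
  have cd := open_cell_inj c'y dy; subst d.
  case: Ed => [/= c'c|[d E0d Fdc']].
    subst c' => z /cE0[cz|[d E0d dz]]; first by exists c => //; left.
    by exists d => //; right; exists d => //; have [] := FP _ E0d.
  have [_ _ Fd] := FP _ E0d.
  have /Fd H : (open_cell c' `&` \bigcup_(d in F d) open_cell d) !=set0.
    by exists y; split=> //; exists c'.
  by move=> z /H[d' Fdd' d'z]; exists d' => //; right; exists d.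
- rewrite finite_setU; split; first exact: finite_set1.
  by apply: bigcup_finite => // d E0d; have [] := FP _ E0d.
Qed.

Lemma compact_finite_cells P : compact P ->
  exists E : set (cell K), finite_set E /\ P `<=` \bigcup_(c in E) open_cell c.
Proof.
move=> cP.
pose sim y z := exists2 c : cell K, open_cell c y & open_cell c z.
have cellP y : exists c : cell K, open_cell c y.
  by have [c [cy _]] := cell_partition K y; exists c.
have [] := @compact_finite_classes Y id sim P.
- by [].
- by move=> y z [c cy cz]; exists c.
- move=> y z w [c cy cz] [d dz dw]; exists c => //.
  by rewrite (open_cell_inj cz dz).
- by move=> c y z cy cz; exists c.
- by move=> y _ <-; have [c cy] := cellP y; exists c.
- by [].
- by rewrite image_id.
move=> D [fD _ PD]; have [k kP] := choice cellP.
exists (k @` D); split; first exact: finite_image.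
move=> y /PD[z Dz [c cy cz]]; exists (k z); first by exists z.
by rewrite (open_cell_inj (kP z) cz).
Qed.

Lemma compact_sub_compact_subcomplex P : compact P ->
  exists Z, [/\ subcomplex K Z, compact Z & P `<=` Z].
Proof.
move=> /compact_finite_cells[E [fE PE]].
have [F FP] := choice cell_finite_subcomplex.
exists (\bigcup_(c in \bigcup_(d in E) F d) open_cell c); split.
- move=> c [y [cy [d [e Ee Fed] dy]]].
  have [_ _ Fe] := FP e.
  have /Fe H : (open_cell c `&` \bigcup_(d in F e) open_cell d) !=set0.
    by exists y; split=> //; exists d.
  by move=> z /H[d' Fed' d'z]; exists d' => //; exists e.
- rewrite (_ : \bigcup_(c in _) _ = \bigcup_(c in \bigcup_(d in E) F d) closed_cell c).
    apply: (@finite_bigcup_compact _ {classic (cell K)}) => [|c _].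
      by apply: bigcup_finite => // d _; have [] := FP d.
    exact: closed_cell_compact.
  apply/seteqP; split=> y [c Ec].
    by move=> /open_cell_sub cy; exists c.
  move: Ec => [e Ee Fec] cy; have [_ _ Fe] := FP e.
  have [z cz] : open_cell c !=set0.
    exists (char_map (0 : 'rV[R]_(cell_dim c))); exists 0 => //.
    by rewrite /open_disk /= big1 ?ltr01// => i _; rewrite mxE expr0n.
  have /Fe H : (open_cell c `&` \bigcup_(d in F e) open_cell d) !=set0.
    by exists z; split=> //; exists c.
  by have [d Fed dy] := H _ cy; exists d => //; exists e.
- move=> y /PE[c Ec cy]; exists c => //; exists c => //.
  by have [] := FP c.
Qed.

End CWComplexes.

Lemma finite_joined (R : realType) (Y : topologicalType) (y0 : Y) (W : set Y) :
  (forall y, joined_in R [set: Y] y y0) -> finite_set W ->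
  exists P, compact P /\ forall y, W y -> joined_in R P y y0.
Proof.
move=> joinY fW.
have /choice[F FP] : forall y, exists P, compact P /\ joined_in R P y y0.
  by move=> y; have [P [cP _ yP]] := joined_in_compact (joinY y); exists P.
exists (\bigcup_(y in W) F y); split.
  by apply: (@finite_bigcup_compact _ {classic Y}) => // y _; have [] := FP y.
by move=> y Wy; apply: joined_in_sub (FP y).2 => z Fz; exists y.
Qed.

(** * Group actions on CW complexes *)

Section GCWComplexes.
Variables (R : realType) (G : groupType) (Y : topologicalType).
Variables (K : cw_structure R Y) (act : group_action G Y).
Hypothesis gcw : gcw_action K act.
Implicit Types (g : G) (c d : cell K) (L Z : set Y) (y z : Y).

Lemma gactK g : cancel (act g) (act g^-1%g).
Proof. by move=> y; rewrite -gactM mulVg gact1. Qed.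

Lemma gactVK g : cancel (act g^-1%g) (act g).
Proof. by move=> y; rewrite -gactM mulgV gact1. Qed.

(** The action is only known to permute the open cells; the closed ones follow by
taking closures. *)
Lemma act_closed_cell g c d :
  act g @` open_cell c = open_cell d -> closed_cell d `<=` act g @` closed_cell c.
Proof.
move=> gcd; apply: subset_trans (@closed_cell_sub_closure _ _ _ _) _.
have actE : act g @` closed_cell c = act g^-1%g @^-1` closed_cell c.
  apply/seteqP; split=> [_ [y cy <-]|y cy] /=; first by rewrite gactK.
  by exists (act g^-1%g y); rewrite ?gactVK.
have cl : closed (act g @` closed_cell c).
  rewrite actE; apply: preimage_closed _ (@closed_cell_closed _ _ _ _).
  by move=> y _; case: gcw => ctn _ _; exact: ctn.
move/closure_id: cl => ->; apply: closureS; rewrite -gcd.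
exact/image_subset/open_cell_sub.
Qed.

Lemma act_subcomplex g Z : subcomplex K Z -> subcomplex K (act g @` Z).
Proof.
move=> subZ c [z [cy [y Zy yz]]]; subst z.
case: gcw => _ /(_ g^-1%g c)[d _ dE] _.
have dy : open_cell d y by rewrite -dE; exists (act g y); rewrite ?gactK.
have cE : act g @` open_cell d = open_cell c.
  rewrite -dE; apply/seteqP; split=> [_ [_ [z cz <-] <-]|z cz]; first by rewrite gactVK.
  by exists (act g^-1%g z); [exists z|rewrite gactVK].
apply: subset_trans (act_closed_cell cE) _; apply: image_subset.
by apply: subZ; exists y.
Qed.

(** A group element that moves a point within its open cell stabilises that cell,
hence fixes it pointwise: each orbit meets an open cell at most once. *)
Lemma gcw_orbit_cell c g y : open_cell c y -> open_cell c (act g y) -> act g y = y.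
Proof.
case: gcw => _ + fix_cell cy cgy => /(_ g c)[d _ dE].
have dgy : open_cell d (act g y) by rewrite -dE; exists y.
by apply: (fix_cell g c) => //; rewrite dE (open_cell_inj dgy cgy).
Qed.

Lemma orbit_projP y z : orbit_proj act y = orbit_proj act z <-> exists g, act g y = z.
Proof.
split=> [/eqquotP/asboolP //|gyz].
by apply/eqquotP/asboolP.
Qed.

Lemma orbit_proj_continuous : continuous (orbit_proj act).
Proof. exact: pi_continuous. Qed.

Lemma orbit_proj_closed (C : set (orbit_space act)) :
  closed (orbit_proj act @^-1` C) -> closed C.
Proof.
move=> /closed_openC cC; rewrite -[C]setCK; apply: open_closedC.
exact: cC.
Qed.

Lemma cocompactU L Z :
  cocompact_subspace act L -> cocompact_subspace act Z ->
  cocompact_subspace act (L `|` Z).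
Proof.
move=> [iL cL] [iZ cZ]; split; last by rewrite image_setU; exact: compactU.
by move=> g y [/iL|/iZ]; [left|right].
Qed.

Lemma translates_cocompact Z :
  compact Z -> cocompact_subspace act (\bigcup_g (act g @` Z)).
Proof.
move=> cZ; split=> [g _ [k _ [y Zy <-]]|].
  by exists (g * k)%g => //; exists y; rewrite ?gactM.
rewrite (_ : _ @` _ = orbit_proj act @` Z).
  apply: continuous_compact cZ; apply: continuous_subspaceT.
  exact: orbit_proj_continuous.
apply/seteqP; split=> [_ [_ [g _ [y Zy <-]] <-]|_ [y Zy <-]].
  by exists y => //; apply/orbit_projP; exists g.
by exists y => //; exists 1%g => //; exists y; rewrite ?gact1.
Qed.

Lemma cocompact_finite_cells L : cocompact_subspace act L ->
  exists E : set (cell K), finite_set E /\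
    forall y, L y -> exists g c, E c /\ open_cell c (act g y).
Proof.
move=> [_ cL].
pose sim y z := exists g, exists2 c : cell K, open_cell c (act g y) & open_cell c z.
have cellP y : exists c : cell K, open_cell c y.
  by have [c [cy _]] := cell_partition K y; exists c.
have gcell g c y : open_cell c y -> exists2 d : cell K,
    open_cell d (act g y) & forall z, open_cell c z -> open_cell d (act g z).
  move=> cy; case: gcw => _ /(_ g c)[d _ dE] _.
  have cd z : open_cell c z -> open_cell d (act g z) by move=> cz; rewrite -dE; exists z.
  by exists d => //; exact: cd.
have [] := @compact_finite_classes _ _ K _ (orbit_proj act) sim L.
- exact: orbit_proj_closed.
- move=> y z [g [c cgy cz]]; exists g^-1%g.
  have [d dz cd] := gcell g^-1%g c z cz; exists d => //.
  by rewrite -[y](gactK g); exact: cd.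
- move=> y z w [g [c cgy cz]] [k [d dkz dw]]; exists (k * g)%g, d => //.
  have [e ekz ce] := gcell k c z cz.
  by rewrite gactM -(open_cell_inj ekz dkz); exact: ce.
- by move=> c y z cy cz; exists 1%g, c; rewrite ?gact1.
- move=> y z /orbit_projP[g <-]; have [c cy] := cellP (act g y).
  by exists g, c.
- move=> c y z cy cz /orbit_projP[g gyz].
  by rewrite -gyz (gcw_orbit_cell (c := c))// gyz.
- exact: cL.
move=> D [fD _ LD]; have [k kP] := choice cellP.
exists (k @` D); split; first exact: finite_image.
move=> y /LD[z Dz [g [c cgy cz]]]; exists g, c; split=> //.
by exists z => //; exact: open_cell_inj (kP z) cz.
Qed.

(** The points W are arbitrary targets for paths from y0; the points of L need to
be moved by the group first, as only finitely many orbits of cells meet L. Each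
such cell is reached through its centre, to which all its points are joined by
segments. *)
Lemma cocompact_sub_translates L (W : set Y) (y0 : Y) :
  cocompact_subspace act L -> finite_set W ->
  (forall y, joined_in R [set: Y] y y0) ->
  exists Z, [/\ subcomplex K Z, compact Z,
    forall y, W y -> joined_in R Z y y0 &
    forall y, L y -> exists g, joined_in R Z (act g y) y0].
Proof.
move=> /cocompact_finite_cells[E [fE LE]] fW joinY.
pose center c : Y := char_map (0 : 'rV[R]_(cell_dim c)).
have fWE : finite_set (W `|` center @` E).
  by rewrite finite_setU; split=> //; exact: finite_image.
have [P [cP PW]] := finite_joined joinY fWE.
have cPE : compact (P `|` \bigcup_(c in E) closed_cell c).
  apply: compactU => //; apply: (@finite_bigcup_compact _ {classic (cell K)}) => // c _.
  exact: closed_cell_compact.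
have [Z [subZ cZ PEZ]] := compact_sub_compact_subcomplex K cPE.
exists Z; split=> //.
  by move=> y Wy; apply: joined_in_sub (PW y _); [move=> z Pz; apply: PEZ; left|left].
move=> y /LE[g [c [Ec cgy]]]; exists g.
apply: (@joined_in_trans _ _ _ _ (center c)).
  apply: joined_in_sym; apply: joined_in_sub (closed_cell_joined (open_cell_sub cgy)).
  by move=> z cz; apply: PEZ; right; exists c.
apply: joined_in_sub (PW (center c) _); first by move=> z Pz; apply: PEZ; left.
by right; exists c.
Qed.

End GCWComplexes.

(** * Horoballs in the tree *)

Section Horoballs.
Variables (R : realType) (M : metricType R) (tau : {nonneg R} -> M).
Implicit Types (t u D : R) (p q : M).

Lemma horoball_anti t u p : t <= u -> horoball tau u p -> horoball tau t p.
Proof. by move=> tu [l /= ul lp]; exists l => /=; lra. Qed.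

Lemma horoball_near t D p q :
  0 <= D -> mdist p q <= D -> horoball tau t p -> horoball tau (t - D) q.
Proof.
move=> D0 pq [l /= tl lp]; exists l => /=; first lra.
by have := metric_triangle (tau l) p q; lra.
Qed.

(** The balls whose union is the horoball are nested. *)
Lemma horoball_common_center t p q : geodesic_ray tau ->
  horoball tau t p -> horoball tau t q ->
  exists l : {nonneg R},
    [/\ t <= l%:num, mdist (tau l) p <= l%:num - t & mdist (tau l) q <= l%:num - t].
Proof.
move=> geo; wlog: p q / exists l l' : {nonneg R},
    [/\ t <= l%:num, l%:num <= l'%:num, mdist (tau l) p <= l%:num - t &
        mdist (tau l') q <= l'%:num - t].
  move=> H [l tl lp] [l' tl' lq].
  have [ll'|/ltW l'l] := leP l%:num l'%:num.
    by apply: H; [exists l, l'|exists l|exists l'].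
  have [|||k [tk kq kp]] := H q p; [by exists l', l|by exists l'|by exists l|].
  by exists k.
move=> [l [l' [tl ll' lp lq]]] _ _; exists l'; split=> //; first exact: le_trans ll'.
have := metric_triangle (tau l') (tau l) p.
by rewrite (geo l' l) ger0_norm ?subr_ge0//; lra.
Qed.

End Horoballs.

Section TreeHoroballs.
Variables (R : realType) (A : groupType) (n : nat) (x : free_basis A n).

Lemma mdist_Vertex a b : mdist (Vertex R x a) (Vertex R x b) = (word_dist x a b)%:R.
Proof.
rewrite /mdist /= /dist_through /dist_vertex /= !add0r !addr0 !minxx.
by [].
Qed.

Lemma mdist_near_end (p : cayley_tree R x) : mdist p (Vertex R x (near_end p)) <= 1.
Proof.
rewrite (le_trans (tree_dist_through _ _))//.
rewrite (le_trans (dist_through_le (c := near_end p) (e := near_off p)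
  (c' := near_end p) (e' := 0) _ _))//; try by left.
by rewrite word_distxx !addr0; case: p => [a|a i s s01] //=; lra.
Qed.

(** The prefixes of a shortest word from a to c end in vertices no farther from c
than a is. *)
Lemma word_chain (rel : A -> A -> Prop) (Q : set A) (a c : A) :
  (forall a, Q a -> rel a a) ->
  (forall a b, rel a b -> rel b a) ->
  (forall a b d, rel a b -> rel b d -> rel a d) ->
  (forall a i, Q a -> Q (a * x i)%g -> rel a (a * x i)%g) ->
  (forall b, (word_dist x b c <= word_dist x a c)%N -> Q b) -> rel a c.
Proof.
move=> relR relC relT relS.
have [w [ws wE]] := word_lenP x (a^-1 * c)%g.
have -> : word_dist x a c = size w by rewrite ws.
have {wE} : (a * word_val x w)%g = c by rewrite wE mulgA mulgV mul1g.
elim: w a {ws} => [|l w IH] a wE Qc.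
  have ac : a = c by rewrite -wE /word_val big_nil mulg1.
  by rewrite ac; apply/relR/Qc; rewrite word_distxx.
have dist_word b v : (b * word_val x v)%g = c -> (word_dist x b c <= size v)%N.
  by move=> <-; rewrite /word_dist mulgA mulVg mul1g word_len_le.
have Qa : Q a by apply: Qc; exact: dist_word wE.
have wE' : (a * letter_val x l * word_val x w)%g = c.
  by rewrite -wE /word_val big_cons mulgA.
have Qc' b : (word_dist x b c <= size w)%N -> Q b by move=> bw; exact/Qc/leqW.
have Qal : Q (a * letter_val x l)%g by apply: Qc'; exact: dist_word wE'.
apply: relT (IH _ wE' Qc').
case: l {wE wE' Qc Qc'} Qal => i [] /=; rewrite /letter_val /= => Qal; first exact: relS.
by apply: relC; rewrite -[X in rel _ X](mulgVK (x i)); apply: relS; rewrite ?mulgVK.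
Qed.

Variable tau : {nonneg R} -> cayley_tree R x.
Hypothesis tau_ray : geodesic_ray tau.

(** The centre of a common ball of a and b is replaced by the vertex c = near_end
at distance at most 1; the walks from a and b to c then leave the ball by at
most 2. *)
Lemma horoball_vertex_chain (rel : A -> A -> Prop) (t : R) (a b : A) :
  (forall a, horoball tau (t - 2) (Vertex R x a) -> rel a a) ->
  (forall a b, rel a b -> rel b a) ->
  (forall a b c, rel a b -> rel b c -> rel a c) ->
  (forall a i, horoball tau (t - 2) (Vertex R x a) ->
     horoball tau (t - 2) (Vertex R x (a * x i)%g) -> rel a (a * x i)%g) ->
  horoball tau t (Vertex R x a) -> horoball tau t (Vertex R x b) -> rel a b.
Proof.
move=> relR relC relT relS Ha Hb.
have [l [tl la lb]] := horoball_common_center tau_ray Ha Hb.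
have lc := mdist_near_end (tau l); set c := near_end (tau l) in lc.
have chain d : mdist (tau l) (Vertex R x d) <= l%:num - t -> rel d c.
  move=> ld.
  apply: (word_chain (Q := fun b => horoball tau (t - 2) (Vertex R x b))) => // d'.
  rewrite -(ler_nat R) -!mdist_Vertex => d'c; exists l => /=; first lra.
  have := metric_triangle (tau l) (Vertex R x c) (Vertex R x d').
  have := metric_triangle (Vertex R x d) (tau l) (Vertex R x c).
  by rewrite (metric_sym (Vertex R x d) (tau l)) (metric_sym (Vertex R x c)); lra.
by apply: relT (chain _ la) _; apply: relC; exact: chain.
Qed.

End TreeHoroballs.

(** * Semidirect products *)

Section SemidirectProducts.
Variables (A B : groupType) (phi : {multiplicative A -> aut B}).
Local Notation G := (sdprod phi).

Lemma sdprod_mulE b a b' a' :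
  (((b, a) : G) * ((b', a') : G))%g = ((b * phi a b')%g, (a * a')%g) :> G.
Proof. by []. Qed.

Lemma aut_funV (f : aut B) b : f b^-1%g = (f b)^-1%g.
Proof. by apply: (mulgI (f b)); rewrite -aut_morph !mulgV aut_fun1. Qed.

(** The elements (b, a0) whose translates phi_a(b) all lie in N form a subgroup. *)
Lemma sdprod_kernel_gen (S : set G) (N : set B) :
  (forall H : set G, H 1%g -> (forall a b, H a -> H b -> H (a / b)%g) ->
     S `<=` H -> forall g, H g) ->
  N 1%g -> (forall a b, N a -> N b -> N (a / b)%g) ->
  (forall g a, S g -> N (phi a g.1)) -> forall b, N b.
Proof.
move=> genS N1 ND NS b.
have := genS (fun g : G => forall a, N (phi a g.1)) _ _ _ ((b, 1%g) : G) 1%g.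
rewrite sdprod_phi1 /=; apply.
- by move=> a; rewrite aut_fun1.
- move=> [b1 a1] [b2 a2] H1 H2 a /=.
  rewrite /= aut_morph -sdprod_phiM -sdprod_phiM aut_funV.
  exact: ND (H1 _) (H2 _).
- by move=> g Sg a; exact: NS.
Qed.

(** The elements b such that right multiplication by b does not leave the
rel-class of any (b0, a) with a in V form a subgroup of B. It contains each
phi_a(b_s): replace phi_a by phi_a1 with a1 in V, and walk from the given vertex
to a1 and back. *)
Lemma sdprod_connected (S : set G) (V : set A) (rel : G -> G -> Prop) :
  (forall H : set G, H 1%g -> (forall a b, H a -> H b -> H (a / b)%g) ->
     S `<=` H -> forall g, H g) ->
  phi @` V = range phi ->
  (forall g k, rel g k -> rel k g) ->
  (forall g k m, rel g k -> rel k m -> rel g m) ->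
  (forall b a a', V a -> V a' -> rel (b, a) (b, a')) ->
  (forall b a g, V a -> S g -> rel (b, a) (b * phi a g.1, a)%g) ->
  forall g k : G, V g.2 -> V k.2 -> rel g k.
Proof.
move=> genS phiV relC relT relA relB.
have relN b : forall b0 a, V a -> rel (b0, a) (b0 * b, a)%g.
  move: b; apply: (sdprod_kernel_gen genS).
  - by move=> b0 a Va; rewrite mulg1; exact: relA.
  - move=> b1 b2 N1 N2 b0 a Va; rewrite mulgA.
    apply: relT (N1 b0 a Va) _; apply: relC.
    by have := N2 (b0 * b1 / b2)%g a Va; rewrite mulgVK.
  - move=> g a Sg b0 a' Va'.
    have [a1 Va1 a1E] : (phi @` V) (phi a) by rewrite phiV; exists a.
    rewrite -a1E; apply: (relT _ _ _ (relA b0 a' a1 Va' Va1)).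
    exact: relT (relB _ _ _ Va1 Sg) (relA _ _ _ Va1 Va').
move=> [b a] [b' a'] /= Va Va'; apply: relT (relA b a a' Va Va') _.
by have := relN (b^-1 * b')%g b a' Va'; rewrite mulgA mulgV mul1g.
Qed.

End SemidirectProducts.

(** * Controlled connectedness *)

Section OverHoroballs.
Variables (R : realType) (G : groupType) (M : metricType R) (rho : isometric_action G M).
Variables (h : control_map rho) (tau : {nonneg R} -> M).

Lemma over_horoball_sub t :
  (over_horoball tau t : set h) `<=` @cm_map _ _ _ _ h @^-1` horoball tau t.
Proof. by move=> y [Z [_ Zt] /Zt]. Qed.

Lemma compact_bounded_from (Z : set h) (o : M) : compact Z ->
  exists2 D, 0 <= D & forall z, Z z -> mdist o (cm_map z) <= D.
Proof.
move=> cZ; have [Z0|Z0] := pselect (Z !=set0); last first.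
  by exists 0 => // z Zz; case: Z0; exists z.
have [|z Zz zmax] := @compact_EVT_max _ _ (fun z : h => mdist o (cm_map z)) Z Z0 cZ.
  apply: continuous_subspaceT => z.
  by apply: continuous_comp; [exact: cm_continuous|exact: mdist_continuous].
exists (mdist o (cm_map z)); first exact: mdist_ge0.
by move=> z' Zz'; apply: zmax; rewrite inE.
Qed.

(** Whether gZ lies over a horoball can be read off, up to the constant D, from
the single point g.o. *)
Lemma translate_sub_over_horoball (Z : set h) (o : M) (D t : R) (g : G) :
  subcomplex (cm_cw h) Z -> 0 <= D -> (forall z, Z z -> mdist o (cm_map z) <= D) ->
  horoball tau t (rho g o) -> cm_act h g @` Z `<=` over_horoball tau (t - D).
Proof.
move=> subZ D0 ZD Ht y gZy.
exists (cm_act h g @` Z) => //; split.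
  exact: act_subcomplex (cm_gcw h) _ _ subZ.
move=> _ [z Zz <-] /=; apply: horoball_near D0 _ Ht.
by rewrite cm_equivariant iact_isom; exact: ZD.
Qed.

Lemma horoball_translate (o : M) (z : h) (D t : R) (g : G) :
  0 <= D -> mdist o (cm_map z) <= D ->
  horoball tau t (cm_map (cm_act h g z)) -> horoball tau (t - D) (rho g o).
Proof.
move=> D0 oz; apply: horoball_near D0 _.
by rewrite cm_equivariant iact_isom metric_sym.
Qed.

End OverHoroballs.

Theorem corollary1 (R : realType) (A B : groupType) (n : nat)
  (x : free_basis A n) (phi : {multiplicative A -> aut B})
  (G_fg : finitely_generated (sdprod phi))
  (h : control_map (tree_action R x phi))
  (e : set ({nonneg R} -> cayley_tree R x)) (e_boundary : boundary e)
  (tau : {nonneg R} -> cayley_tree R x) (tau_ray : geodesic_ray tau)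
  (tau0 : tau 0%:nng = Vertex R x 1%g) (tau_e : ray_end tau = e)
  (phi_horoball : forall k : int, 0 <= k ->
     phi @` horoball_vertices tau k = range phi) :
  Sigma1 h (Vertex R x 1%g) e.
Proof.
exists tau => //; split=> // L cocL.
have [s genS] := G_fg.
have [y0 joinY] := contractible_joined (cm_contractible h).
pose S := [set g | g \in s].
(* The moves: 1 for trivial walks, the generators of A, and the B-components
   of the generators of G. *)
pose gen : set (sdprod phi) := [set 1%g] `|`
  range (fun i => (1%g, x i) : sdprod phi) `|`
  (fun g : sdprod phi => (g.1, 1%g) : sdprod phi) @` S.
have fin_gen : finite_set gen.
  rewrite !finite_setU; split; [split|]; first exact: finite_set1.
    by apply: finite_image; exact: finite_finset.
  by apply: finite_image; exact: finite_seq.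
have [Z [subZ cZ genZ LZ]] := cocompact_sub_translates (cm_gcw h) cocL
  (finite_image (fun g => cm_act h g y0) fin_gen) joinY.
have [D D0 ZD] := compact_bounded_from (Vertex R x 1%g) cZ.
pose L' := L `|` \bigcup_g (cm_act h g @` Z).
exists L'; split; [|by left|].
  exact: cocompactU cocL (translates_cocompact _ cZ).
pose W u : set h := over_horoball tau u `&` L'.
pose H u : set (sdprod phi) := [set g | horoball tau u (Vertex R x g.2)].
have joinW u g y z : H u g -> joined_in R Z y z ->
    joined_in R (W (u - D)) (cm_act h g y) (cm_act h g z).
  move=> Hg yz; apply: joined_in_sub (joined_in_image (f := cm_act h g) _ yz).
    move=> w Zw; split; last by right; exists g.
    apply: translate_sub_over_horoball subZ D0 ZD _ _ Zw => /=.
    by rewrite /tree_act /= mulg1.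
  by have [ctn _ _] := cm_gcw h; exact: ctn.
have join_gen u g k : H u g -> gen k ->
    joined_in R (W (u - D)) (cm_act h g y0) (cm_act h (g * k)%g y0).
  move=> Hg genk; rewrite gactM; apply: joinW => //; apply: joined_in_sym.
  by apply: genZ; exists k.
suff connW t y z : (over_horoball tau t `&` L) y -> (over_horoball tau t `&` L) z ->
    joined_in R (W (t - (2 * D + 2))) y z.
  move=> t; exists (2 * D + 2); first lra.
  split=> y z Hy Hz; first exact: connW Hy Hz.
  by have := connW _ _ _ Hy Hz; rewrite addrK.
(* Points of L over level t are next to vertices of level u; walks between
   these stay at level u - 2, and their translates of Z at level u - 2 - D. *)
pose u := t - D.
have tE : t - (2 * D + 2) = (u - 2) - D by rewrite /u; lra.
have Hsub g : H u g -> H (u - 2) g by apply: horoball_anti; lra.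
have base w : (over_horoball tau t `&` L) w -> exists2 g, H u g &
    joined_in R (W (u - 2 - D)) w (cm_act h g y0).
  move=> [Hw Lw]; have [g gw] := LZ _ Lw.
  have wE : w = cm_act h g^-1%g (cm_act h g w) by rewrite gactK.
  have Zgw : Z (cm_act h g w) by have [f [_ <- _ Zf]] := gw; apply: Zf; lra.
  have Hg : H u g^-1%g.
    rewrite /H /= -[X in Vertex R x X]mulg1.
    apply: (horoball_translate (h := h) (t := t) (g := g^-1%g)
      (z := cm_act h g w) D0 (ZD _ Zgw)).
    by rewrite gactK; exact: over_horoball_sub Hw.
  exists g^-1%g => //; rewrite {1}wE; apply: joinW gw; exact: Hsub.
rewrite tE => /base[g Hg yg] /base[k Hk zk].
apply: joined_in_trans yg (joined_in_trans _ (joined_in_sym zk)).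
pose rel g k := joined_in R (W (u - 2 - D)) (cm_act h g y0) (cm_act h k y0).
have relC g1 g2 : rel g1 g2 -> rel g2 g1 by exact: joined_in_sym.
have relT g1 g2 g3 : rel g1 g2 -> rel g2 g3 -> rel g1 g3 by exact: joined_in_trans.
apply: (sdprod_connected (S := S) (rel := rel)
  (V := [set a | horoball tau u (Vertex R x a)])) => //.
- apply/seteqP; split=> [_ [a _ <-]|]; first by exists a.
  have uk : u <= (Num.truncn u).+1%:Z%:~R by exact/ltW/truncnS_gt.
  rewrite -(phi_horoball (Num.truncn u).+1%:Z)//; apply: image_subset => a.
  exact: horoball_anti.
- move=> b a a'.
  apply: (horoball_vertex_chain tau_ray (rel := fun a a' => rel (b, a) (b, a'))).
  + move=> a1 Ha1; apply: (joinW _ (b, a1)); first exact: Ha1.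
    by rewrite -{1}(gact1 (cm_act h) y0); apply: genZ; exists 1%g => //; left; left.
  + by move=> *; exact: relC.
  + move=> a1 a2 a3; exact: relT.
  + move=> a1 i Ha1 _.
    have -> : (b, (a1 * x i)%g) = (((b, a1) : sdprod phi) * ((1, x i) : sdprod phi))%g.
      by rewrite sdprod_mulE aut_fun1 mulg1.
    by apply: join_gen => //; left; right; exists i.
- move=> b a g1 Ha Sg1.
  have -> : ((b * phi a g1.1)%g, a) =
      (((b, a) : sdprod phi) * ((g1.1, 1) : sdprod phi))%g.
    by rewrite sdprod_mulE mulg1.
  by apply: join_gen; [exact: Hsub|right; exists g1].
Qed.
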